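(* Let $0 < a < \frac14$, set $L_a = [-2a,2a]^2 \setminus [-a,a]^2$, and let $0 < \delta < \frac12 \min\{1-4a, a\}$. Define $g_{(L_a;\delta,\frac{\delta}{2})}:\mathbb{R}^2\to\mathbb{R}$ by (the first applicable case being used) $$g_{(L_a;\delta,\frac{\delta}{2})}(x,y)=\begin{cases} \theta\left(\frac{2a-|y|}{\delta}\right) & |x| \in [0,2a-\delta],\ |y| \in [2a - \delta, 2a + \delta],\\ \theta\left(\frac{2a-|y|}{\delta}\right)\theta\left(\frac{2a-|x|}{\delta}\right) & |x|,|y| \in [2a - \delta, 2a + \delta],\\ \theta\left(\frac{2a-|x|}{\delta}\right) & |y| \in [0,2a-\delta],\ |x| \in [2a - \delta, 2a + \delta],\\ 1 & (|x|,|y|) \in [0,2a-\delta]^2 \setminus [0,a + \frac{\delta}{2}]^2,\\ \theta\left(\frac{|y|-a}{\delta/2}\right) & |x| \in [0,a-\frac{\delta}{2}],\ |y| \in [a - \frac{\delta}{2}, a + \frac{\delta}{2}],\\ \theta\left(\frac{|y|-a}{\delta/2}\right)\theta\left(\frac{|x|-a}{\delta/2}\right) & |x|,|y| \in [a - \frac{\delta}{2}, a + \frac{\delta}{2}],\\ \theta\left(\frac{|x|-a}{\delta/2}\right) & |y| \in [0,a-\frac{\delta}{2}],\ |x| \in [a - \frac{\delta}{2}, a + \frac{\delta}{2}],\\ 0 & \text{otherwise.} \end{cases}$$ Then it is not the case that $\sum_{n\in\mathbb{Z}} g_{(L_a;\delta,\frac{\delta}{2})}^2(2^n x, 2^n y)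 = 1$ for almost every $(x,y)\in\mathbb{R}^2$.
   Context: Fix a function $\theta \in C^\infty(\mathbb{R})$, real-valued, with $\theta(x)=0$ for $x\le -1$, $\theta(x)=1$ for $x \ge 1$, and $\theta(x)^2+\theta(-x)^2=1$ for all $x\in\mathbb{R}$ (such functions exist). *)

(* Defs.v *)
From HB Require Import structures.
From mathcomp Require Import all_boot all_order all_algebra.
From mathcomp Require Import all_classical all_reals all_analysis.
Set Implicit Arguments.
Unset Strict Implicit.
Unset Printing Implicit Defensive.
Import Order.TTheory GRing.Theory Num.Theory.
Import numFieldNormedType.Exports.
Local Open Scope ring_scope.

Definition smooth (R : realType) (f : R -> R) : Prop :=
  forall (n : nat) (x : R), derivable (derive1n n f) x 1.

Definition cutoff (R : realType) (theta : R -> R) : Prop :=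
  [/\ smooth theta,
      forall x : R, x <= -1 -> theta x = 0,
      forall x : R, 1 <= x -> theta x = 1
    & forall x : R, theta x ^+ 2 + theta (- x) ^+ 2 = 1].

(* The smoothed indicator of [-2a, 2a]^2 \ [-a, a]^2, with transition
   half-width delta along the outer boundary and delta / 2 along the inner one.
   Adjacent cases share boundary points, where the first one applies. *)
Definition smoothed_indicator (R : realType) (theta : R -> R) (a delta : R)
    (p : R * R) : R :=
  let x := `|p.1| in
  let y := `|p.2| in
  let eps := delta / 2 in
  if (x \in `[0, 2 * a - delta]) && (y \in `[2 * a - delta, 2 * a + delta])
  then theta ((2 * a - y) / delta)
  else if (x \in `[2 * a - delta, 2 * a + delta])
          && (y \in `[2 * a - delta, 2 * a + delta])
  then theta ((2 * a - y) / delta) * theta ((2 * a - x) / delta)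
  else if (y \in `[0, 2 * a - delta])
          && (x \in `[2 * a - delta, 2 * a + delta])
  then theta ((2 * a - x) / delta)
  else if ((x \in `[0, 2 * a - delta]) && (y \in `[0, 2 * a - delta]))
          && ~~ ((x \in `[0, a + eps]) && (y \in `[0, a + eps]))
  then 1
  else if (x \in `[0, a - eps]) && (y \in `[a - eps, a + eps])
  then theta ((y - a) / eps)
  else if (x \in `[a - eps, a + eps]) && (y \in `[a - eps, a + eps])
  then theta ((y - a) / eps) * theta ((x - a) / eps)
  else if (y \in `[0, a - eps]) && (x \in `[a - eps, a + eps])
  then theta ((x - a) / eps)
  else 0.

(* Main.v *)
Require Import Defs.
From HB Require Import structures.
From mathcomp Require Import all_boot all_order all_algebra.
From mathcomp Require Import all_classical all_reals all_analysis.
From mathcomp Require Import ring lra.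
Import Order.TTheory GRing.Theory Num.Theory.
Import numFieldNormedType.Exports.
Local Open Scope ring_scope.

(** The sum fails near the inner corner [(a, a)].  For [x, y] within
    [delta / 2] of [a], only the scales [n = 0] and [n = 1] contribute: smaller
    scales land inside the hole and larger ones outside the support.  With
    [s] and [t] the values of [theta ^+ 2] at [(x - a) / (delta / 2)] and
    [(y - a) / (delta / 2)], the inner corner at scale [0] contributes [s * t],
    while the outer corner at scale [1] contributes [(1 - s) * (1 - t)], because
    [theta u ^+ 2 + theta (- u) ^+ 2 = 1].  The total is
    [1 - (s * (1 - t) + t * (1 - s))] (lemma [dyadic_sum_near_corner]), which
    is less than [1] as soon as [0 < s < 1] and [0 < t < 1].  Since
    [theta 0 ^+ 2 = 1 / 2] and [theta] is continuous, this happens on a whole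
    square centred at [(a, a)], and a square is not negligible
    (lemma [square_not_negligible]). *)

(* Proves conjunctions of inequalities, one conjunct at a time. *)
Local Ltac split_andb :=
  repeat match goal with |- is_true (_ && _) => apply/andP; split end.
Local Ltac lra_all := split_andb; lra.
Local Ltac nra_all := split_andb; nra.

(* Discards a case of [smoothed_indicator] whose two coordinate ranges are
   incompatible with the hypotheses. *)
Local Ltac skip_case :=
  rewrite ifF;
  last by (apply/negP => /andP[/andP[? ?] /andP[? ?]]; lra).

Section corner.
Context {R : realType} (theta : R -> R) (a delta : R).

Let g := smoothed_indicator theta a delta.

Lemma smoothed_indicator_hole (x y : R) :
    0 < delta -> 2 * delta < a ->
    0 <= x < a - delta / 2 -> 0 <= y < a - delta / 2 ->
  g (x, y) = 0.
Proof.
move=> delta_gt0 delta_lt /andP[x0 xa] /andP[y0 ya].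
rewrite /g /smoothed_indicator /= !ger0_norm// !in_itv /=.
do 3 skip_case.
rewrite ifF; last first.
  by apply/negP => /andP[_ /negP]; apply; lra_all.
by do 3 skip_case.
Qed.

Lemma smoothed_indicator_outside (x y : R) :
    0 < delta -> 2 * delta < a ->
    2 * a + delta < x -> 2 * a + delta < y ->
  g (x, y) = 0.
Proof.
move=> delta_gt0 delta_lt xa ya.
rewrite /g /smoothed_indicator /= !ger0_norm; [|lra|lra].
rewrite !in_itv /=.
do 3 skip_case.
rewrite ifF; last first.
  by apply/negP => /andP[/andP[/andP[? ?] _] _]; lra.
by do 3 skip_case.
Qed.

Lemma smoothed_indicator_outer_corner (x y : R) :
    0 < delta -> 2 * delta < a ->
    2 * a - delta < x < 2 * a + delta -> 2 * a - delta < y < 2 * a + delta ->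
  g (x, y) = theta ((2 * a - y) / delta) * theta ((2 * a - x) / delta).
Proof.
move=> delta_gt0 delta_lt /andP[x0 xa] /andP[y0 ya].
rewrite /g /smoothed_indicator /= !ger0_norm; [|lra|lra].
rewrite !in_itv /=.
skip_case.
by rewrite ifT//; lra_all.
Qed.

Lemma smoothed_indicator_inner_corner (x y : R) :
    0 < delta -> 2 * delta < a ->
    a - delta / 2 < x < a + delta / 2 -> a - delta / 2 < y < a + delta / 2 ->
  g (x, y) = theta ((y - a) / (delta / 2)) * theta ((x - a) / (delta / 2)).
Proof.
move=> delta_gt0 delta_lt /andP[x0 xa] /andP[y0 ya].
rewrite /g /smoothed_indicator /= !ger0_norm; [|lra|lra].
rewrite !in_itv /=.
do 3 skip_case.
rewrite ifF; last first.
  by apply/negP => /andP[_ /negP]; apply; lra_all.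
skip_case.
by rewrite ifT//; lra_all.
Qed.

Lemma smoothed_indicator_dilation_eq0 (x y : R) (n : int) :
    0 < delta -> 2 * delta < a ->
    a - delta / 2 < x < a + delta / 2 -> a - delta / 2 < y < a + delta / 2 ->
    n != 0 -> n != 1 ->
  g (2 ^ n * x, 2 ^ n * y) = 0.
Proof.
move=> delta_gt0 delta_lt /andP[x0 xa] /andP[y0 ya].
case: n => [[|[|k]]|k] // _ _.
(* [n >= 2]: both coordinates are at least [4 * (a - delta / 2)], beyond
   [2 * a + delta]. *)
- have k4 : 4 <= 2 ^ (k.+2 : int) :> R.
    rewrite (_ : 4 = 2 ^+ 2); last by rewrite -natrX.
    by rewrite -exprnP ler_eXn2l// ltr1n.
  by apply: smoothed_indicator_outside; nra.
(* [n < 0]: both coordinates are at most [(a + delta / 2) / 2], below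
   [a - delta / 2]. *)
- have k0 : 0 < 2 ^ Negz k :> R by rewrite exprz_gt0.
  have k2 : 2 ^ Negz k <= 1 / 2 :> R.
    rewrite NegzE -exprnN div1r lef_pV2 ?posrE ?exprn_gt0//.
    by rewrite -[leLHS]expr1 ler_eXn2l// ltr1n.
  by apply: smoothed_indicator_hole; nra_all.
Qed.

(** On the square of half-width [delta / 2] around [(a, a)] the sum reduces to
    the scales [n = 0] (inner corner) and [n = 1] (outer corner).  Doubling the
    point matches the two transition profiles because the outer transition is
    twice as wide as the inner one. *)
Lemma dyadic_sum_near_corner (x y : R) :
    0 < delta -> 2 * delta < a ->
    (forall u, theta u ^+ 2 + theta (- u) ^+ 2 = 1) ->
    a - delta / 2 < x < a + delta / 2 -> a - delta / 2 < y < a + delta / 2 ->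
  let s := theta ((x - a) / (delta / 2)) ^+ 2 in
  let t := theta ((y - a) / (delta / 2)) ^+ 2 in
  (\esum_(n in [set: int]%classic) ((g (2 ^ n * x, 2 ^ n * y)) ^+ 2)%:E
   = (s * t + (1 - s) * (1 - t))%:E)%E.
Proof.
move=> delta_gt0 delta_lt theta2 hx hy s t.
have g0 : g (2 ^ (0 : int) * x, 2 ^ (0 : int) * y) ^+ 2 = s * t.
  rewrite expr0z !mul1r smoothed_indicator_inner_corner//.
  by rewrite exprMn mulrC.
have g1 : g (2 ^ (1 : int) * x, 2 ^ (1 : int) * y) ^+ 2 = (1 - s) * (1 - t).
  have [/andP[? ?] /andP[? ?]] := (hx, hy).
  rewrite expr1z smoothed_indicator_outer_corner//; [|lra_all|lra_all].
  have scale z : (2 * a - 2 * z) / delta = - ((z - a) / (delta / 2)).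
    by field; rewrite gt_eqF.
  have compl u : theta (- u) ^+ 2 = 1 - theta u ^+ 2.
    by rewrite -(theta2 u) addrAC subrr add0r.
  by rewrite !scale exprMn !compl mulrC.
have sq_ge0 n : (0 <= (g (2 ^ n * x, 2 ^ n * y) ^+ 2)%:E)%E.
  by rewrite lee_fin sqr_ge0.
rewrite (esumID [set 0; 1 : int]%classic)//.
rewrite [X in (_ + X)%E]esum1 ?adde0; last first.
  move=> n [_] /not_orP[/eqP n0 /eqP n1].
  by rewrite smoothed_indicator_dilation_eq0// expr0n.
rewrite setTI esum_fset //.
rewrite fsbigU0 /=; [|exact: finite_set1|exact: finite_set1|by move=> n [/= ->]].
by rewrite !fsbig_set1 g0 g1 EFinD.
Qed.

End corner.

(** The complementarity relation at [0] forces [theta 0 ^+ 2 = 1 / 2], and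
    continuity does the rest. *)
Lemma cutoff_sqr_interior_near0 {R : realType} (theta : R -> R) :
    cutoff theta ->
  exists2 r, 0 < r & forall u, `|u| < r -> 0 < theta u ^+ 2 < 1.
Proof.
move=> [theta_smooth _ _ theta2].
have theta_cont : {for 0, continuous theta}.
  apply/differentiable_continuous/derivable1_diffP.
  exact: (theta_smooth 0%N 0).
have sqr_cont : (theta u ^+ 2 @[u --> 0] --> theta 0 ^+ 2)%classic.
  by rewrite expr2; under eq_fun do rewrite expr2; exact: cvgM.
have half : theta 0 ^+ 2 = 1 / 2.
  by have := theta2 0; rewrite oppr0; lra.
have sqr_near : \forall u \near (0 : R), 0 < theta u ^+ 2 < 1.
  near=> u; apply/andP; split; near: u.
  - by apply: (cvgr_gt _ sqr_cont); rewrite half; lra.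
  - by apply: (cvgr_lt _ sqr_cont); rewrite half; lra.
have [r /= r0 hr] := (nbhs_ballP _ _).1 sqr_near.
exists r => // u ur; apply: hr.
by rewrite -ball_normE /ball_ /= sub0r normrN.
Unshelve. all: by end_near. Qed.

Lemma square_not_negligible {R : realType} (c r : R) :
    0 < r ->
  let I : set R := `]c - r, c + r[%classic in
  ~ ((lebesgue_measure \x lebesgue_measure)%E.-negligible (I `*` I)%classic).
Proof.
move=> r0 I.
have mI : measurable I by exact: measurable_itv.
rewrite negligibleP; last exact: measurableX.
move=> I0.
have I_len : lebesgue_measure I = (2 * r)%:E.
  have -> := lebesgue_measure_itv `]c - r, c + r[.
  rewrite /= lte_fin ifT; last lra.
  by rewrite -EFinD; congr EFin; ring.
have := product_measure1E lebesgue_measure lebesgue_measure mI mI.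
rewrite I0 /= I_len -EFinM => -[] /eqP.
by rewrite lt_eqF//; nra.
Qed.

Theorem proposition15 (R : realType) (theta : R -> R) (htheta : cutoff theta)
    (a : R) (ha0 : 0 < a) (ha1 : a < 1 / 4)
    (delta : R) (hdelta0 : 0 < delta)
    (hdelta1 : delta < 1 / 2 * Num.min (1 - 4 * a) a) :
  ~ {ae (lebesgue_measure \x lebesgue_measure)%E, forall p : R * R,
      (\esum_(n in [set: int]%classic)
        ((smoothed_indicator theta a delta (2 ^ n * p.1, 2 ^ n * p.2)) ^+ 2)%:E
       = 1)%E}.
Proof.
have delta_lt : 2 * delta < a.
  have : Num.min (1 - 4 * a) a <= a by rewrite ge_min lexx orbT.
  by lra.
have [r0 r0_gt0 theta_in] := cutoff_sqr_interior_near0 theta htheta.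
have [_ _ _ theta2] := htheta.
have eps_gt0 : 0 < delta / 2 by lra.
(* A square small enough for [theta ^+ 2] to stay in ]0, 1[ and for only the
   two scales to contribute. *)
pose r := Num.min 1 r0 * (delta / 2).
have r_gt0 : 0 < r by rewrite mulr_gt0// lt_min ltr01.
have r_le : r <= delta / 2 by rewrite ler_piMl ?ge_min ?lexx// ltW.
have close z : z \in `]a - r, a + r[ ->
    [/\ a - delta / 2 < z < a + delta / 2
      & 0 < theta ((z - a) / (delta / 2)) ^+ 2 < 1].
  rewrite in_itv /= => /andP[z1 z2]; split; first by lra_all.
  apply: theta_in; rewrite normrM normfV (gtr0_norm eps_gt0) ltr_pdivrMr//.
  apply: (@lt_le_trans _ _ r); first by rewrite ltr_norml; lra_all.
  by rewrite ler_pM2r// ge_min lexx orbT.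
move=> ae_sum; apply: (square_not_negligible a r r_gt0).
apply: negligibleS ae_sum => -[x y] /= [/close[hx /andP[s0 s1]]].
move=> /close[hy /andP[t0 t1]].
rewrite dyadic_sum_near_corner// => -[].
by nra.
Qed.
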